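(* Let $ABC$ be a triangle in the Euclidean plane with circumcircle $\omega$, and let $P$ be any point inside triangle $ABC$. Let $A', B', C'$ be the second intersection points (distinct from $A, B, C$ respectively) of the lines $AP, BP, CP$ with $\omega$. Let $\omega_1$ be the circle passing through $A'$ and $P$ and tangent to $\omega$ at $A'$; it intersects the side $BC$ at points $A_b$ and $A_c$. Let $\omega_2$ be the circle passing through $B'$ and $P$ and tangent to $\omega$ at $B'$; it intersects the side $CA$ at points $B_c$ and $B_a$. Let $\omega_3$ be the circle passing through $C'$ and $P$ and tangent to $\omega$ at $C'$; it intersects the side $AB$ at points $C_a$ and $C_b$. If the six points $A_b, A_c, B_c, B_a, C_a, C_b$ lie on one circle, then $P$ is the Lemoine (symmedian) point of triangle $ABC$.
   Context: The Lemoine point (symmedian point) of a triangle is the common point of its three symmedians, a symmedian being the reflection of a median across the internal angle bisector from the same vertex. *)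

(* Defs.v *)
From Stdlib Require Import Reals.
Open Scope R_scope.

Definition point : Type := (R * R)%type.

Definition padd (X Y : point) : point := (fst X + fst Y, snd X + snd Y).
Definition psub (X Y : point) : point := (fst X - fst Y, snd X - snd Y).
Definition pscal (t : R) (X : point) : point := (t * fst X, t * snd X).
Definition dot (X Y : point) : R := fst X * fst Y + snd X * snd Y.
Definition pdist (X Y : point) : R := dist_euc (fst X) (snd X) (fst Y) (snd Y).
Definition midpoint (X Y : point) : point := pscal (1 / 2) (padd X Y).

(* Lines are handled as predicates on points; [line X Y] is a genuine line
   only when X and Y are distinct. *)
Definition line (X Y : point) (Z : point) : Prop :=
  exists t : R, Z = padd X (pscal t (psub Y X)).

Definition segment (X Y : point) (Z : point) : Prop :=
  exists t : R, 0 <= t <= 1 /\ Z = padd X (pscal t (psub Y X)).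

Definition collinear (X Y Z : point) : Prop :=
  exists U V : point, U <> V /\ line U V X /\ line U V Y /\ line U V Z.

Definition is_triangle (A B C : point) : Prop := ~ collinear A B C.

Definition inside_triangle (A B C P : point) : Prop :=
  exists u v w : R, 0 < u /\ 0 < v /\ 0 < w /\ u + v + w = 1 /\
    P = padd (pscal u A) (padd (pscal v B) (pscal w C)).

Record circle : Type := Circle {
  center : point;
  radius : R;
  radius_pos : 0 < radius
}.

Definition on_circle (c : circle) (X : point) : Prop :=
  pdist (center c) X = radius c.

Definition tangent_at (c1 c2 : circle) (T : point) : Prop :=
  forall X : point, (on_circle c1 X /\ on_circle c2 X) <-> X = T.

(* Unoriented angle XYZ with vertex Y, in [0, PI]; meaningful when X and Z
   both differ from Y. *)
Definition angle (X Y Z : point) : R :=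
  acos (dot (psub X Y) (psub Z Y) / (pdist Y X * pdist Y Z)).

Definition median (A B C : point) : point -> Prop := line A (midpoint B C).

(* The line from A through the point D of the side BC that halves the angle
   BAC; requiring D on the side selects the internal bisector. *)
Definition internal_bisector (A B C : point) (X : point) : Prop :=
  exists D : point,
    segment B C D /\ angle B A D = angle D A C /\ line A D X.

Definition is_reflection (l : point -> Prop) (X X' : point) : Prop :=
  l (midpoint X X') /\
  forall U V : point, l U -> l V -> dot (psub X' X) (psub V U) = 0.

Definition symmedian (A B C : point) (X' : point) : Prop :=
  exists X : point,
    median A B C X /\ is_reflection (internal_bisector A B C) X X'.

Definition is_lemoine_point (A B C P : point) : Prop :=
  symmedian A B C P /\ symmedian B C A P /\ symmedian C A B P.

(* Main.v *)
(* Write [a, b, c] for the squared side lengths and [u, v, w] for the barycentric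
   coordinates of [P].  The circle [w1] is the image of the circumcircle under the
   homothety of centre [A'] taking [A] to [P], which gives the power of [B] with
   respect to [w1] as [w^2 a b / (v c + w b)].  By symmetry the power of [B] with
   respect to [w3] is [u^2 c b / (u b + v a)].  Both equal the power of [B] with
   respect to the circle through the six points, and the difference of the two
   expressions factors as [w a - u c] times a positive quantity.  Hence [u : v : w = a : b : c],
   and these are the barycentric coordinates of the Lemoine point. *)
Require Import Defs.
From Stdlib Require Import Reals Psatz.
Open Scope R_scope.

(** * Squared distances, powers of points and nondegenerate triangles *)

(** Squared distances keep the metric identities polynomial in the coordinates, within reach of
    [ring]. *)
Definition sqdist (X Y : point) : R := dot (psub Y X) (psub Y X).

Definition power (c : circle) (X : point) : R :=
  sqdist (center c) X - radius c * radius c.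

(** At [psub B A] and [psub C A] this is twice the signed area of the triangle. *)
Definition cross (X Y : point) : R := fst X * snd Y - snd X * fst Y.

Definition barycentric (A B C P : point) (u v w : R) : Prop :=
  u + v + w = 1 /\ P = padd (pscal u A) (padd (pscal v B) (pscal w C)).

Ltac coordinates :=
  repeat match goal with X : point |- _ => destruct X end;
  unfold sqdist, power, cross, barycentric, midpoint, padd, psub, pscal, dot in *; simpl in *.

Lemma point_eq_or_neq (X Y : point) : X = Y \/ X <> Y.
Proof.
  destruct X as [x1 x2], Y as [y1 y2].
  destruct (Req_dec x1 y1); [destruct (Req_dec x2 y2)|];
    [left; congruence|right; congruence|right; congruence].
Qed.

Lemma sqdist_sym X Y : sqdist X Y = sqdist Y X.
Proof. coordinates; ring. Qed.

Lemma sqdist_pos X Y : X <> Y -> 0 < sqdist X Y.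
Proof.
  destruct X as [x1 x2], Y as [y1 y2]; intros H; coordinates.
  destruct (Req_dec y1 x1) as [<-|n]; [destruct (Req_dec y2 x2) as [<-|n]|].
  - now contradiction H.
  - apply Rplus_le_lt_0_compat; [apply Rle_0_sqr | apply Rsqr_pos_lt; lra].
  - apply Rplus_lt_le_0_compat; [apply Rsqr_pos_lt; lra | apply Rle_0_sqr].
Qed.

Lemma pdist_nonneg X Y : 0 <= pdist X Y.
Proof. apply sqrt_pos. Qed.

Lemma pdist_sqr X Y : pdist X Y * pdist X Y = sqdist X Y.
Proof.
  unfold pdist, dist_euc; rewrite sqrt_sqrt.
  - coordinates; unfold Rsqr; ring.
  - apply Rplus_le_le_0_compat; apply Rle_0_sqr.
Qed.

Lemma pdist_pos X Y : X <> Y -> 0 < pdist X Y.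
Proof.
  intros H; generalize (sqdist_pos _ _ H) (pdist_sqr X Y) (pdist_nonneg X Y); nra.
Qed.

Lemma pdist_sym X Y : pdist X Y = pdist Y X.
Proof. apply distance_symm. Qed.

Lemma on_circle_power c X : on_circle c X <-> power c X = 0.
Proof.
  unfold on_circle, power; rewrite <- pdist_sqr.
  generalize (pdist_nonneg (center c) X) (radius_pos c); intros; split; nra.
Qed.

(** If the area vanishes, a common line is AB when A and B differ, else BC when B and C differ, else
    any line through the single point. *)
Lemma is_triangle_cross A B C :
  is_triangle A B C -> cross (psub B A) (psub C A) <> 0.
Proof.
  intros H E; apply H; clear H.
  destruct A as [a1 a2], B as [b1 b2], C as [c1 c2]; coordinates.
  assert (P : forall p1 p2 q1 q2 r1 r2 : R, (p1, p2) <> (q1, q2) :> point ->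
    (q1 - p1) * (r2 - p2) - (q2 - p2) * (r1 - p1) = 0 -> line (p1, p2) (q1, q2) (r1, r2)).
  { intros p1 p2 q1 q2 r1 r2 N Z.
    assert (S : (q1 - p1) * (q1 - p1) + (q2 - p2) * (q2 - p2) <> 0).
    { apply Rgt_not_eq; generalize (sqdist_pos _ _ N); unfold sqdist, dot; simpl; lra. }
    (* This is the parameter of the orthogonal projection of r on the line pq; the zero cross
       product makes r its own projection. *)
    exists (((r1 - p1) * (q1 - p1) + (r2 - p2) * (q2 - p2)) /
            ((q1 - p1) * (q1 - p1) + (q2 - p2) * (q2 - p2))).
    unfold padd, pscal, psub; simpl; f_equal;
      apply (Rmult_eq_reg_r ((q1 - p1) * (q1 - p1) + (q2 - p2) * (q2 - p2))); trivial;
      field_simplify; trivial.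
    - apply Rminus_diag_uniq; transitivity (- (q2 - p2) * ((q1 - p1) * (r2 - p2) - (q2 - p2) * (r1 - p1)));
        [ring | rewrite Z; ring].
    - apply Rminus_diag_uniq; transitivity ((q1 - p1) * ((q1 - p1) * (r2 - p2) - (q2 - p2) * (r1 - p1)));
        [ring | rewrite Z; ring]. }
  destruct (point_eq_or_neq (a1, a2) (b1, b2)) as [e|n].
  - injection e as -> ->.
    destruct (point_eq_or_neq (b1, b2) (c1, c2)) as [e|n].
    + injection e as -> ->.
      exists (c1, c2), (c1 + 1, c2); split; [intros e; injection e; lra|].
      repeat split; exists 0; unfold padd, pscal, psub; simpl; f_equal; ring.
    + exists (b1, b2), (c1, c2); repeat split; trivial; apply P; trivial; ring.
  - exists (a1, a2), (b1, b2); repeat split; trivial; apply P; trivial; ring.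
Qed.

Lemma cross_neq A B C :
  cross (psub B A) (psub C A) <> 0 -> A <> B /\ B <> C /\ C <> A.
Proof.
  intros H; repeat split; intros e; subst; apply H; coordinates; ring.
Qed.

Lemma cross_rot A B C :
  cross (psub C B) (psub A B) = cross (psub B A) (psub C A).
Proof. coordinates; ring. Qed.

Lemma cross_swap A B C :
  cross (psub C A) (psub B A) = - cross (psub B A) (psub C A).
Proof. coordinates; ring. Qed.

Lemma barycentric_rot A B C P u v w :
  barycentric A B C P u v w -> barycentric B C A P v w u.
Proof. intros [H ->]; split; [lra|]; coordinates; f_equal; ring. Qed.

Lemma barycentric_swap A B C P u v w :
  barycentric A B C P u v w -> barycentric A C B P u w v.
Proof. intros [H ->]; split; [lra|]; coordinates; f_equal; ring. Qed.

(** * Tangent circles and the power of a vertex *)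

(* The image of [T] under the reflection in the line of centres is a common
   point of the circles, so it is [T]. *)
Lemma tangent_at_center c1 c2 T :
  on_circle c1 T -> on_circle c2 T -> tangent_at c1 c2 T ->
  exists m, center c2 = padd (center c1) (pscal m (psub T (center c1))).
Proof.
  intros h1 h2 tan; rewrite on_circle_power in h1, h2.
  generalize (radius_pos c1); intros r1p.
  destruct (point_eq_or_neq (center c1) (center c2)) as [e|n].
  { exists 0; rewrite <- e; destruct (center c1); coordinates; f_equal; ring. }
  apply sqdist_pos in n.
  set (n2 := sqdist (center c1) (center c2)) in *.
  (* [k] locates the orthogonal projection of [T] on the line of centres. *)
  set (k := dot (psub T (center c1)) (psub (center c2) (center c1)) / n2).
  assert (K : k * n2 = dot (psub T (center c1)) (psub (center c2) (center c1))).
  { unfold k; field; lra. }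
  set (X := padd (center c1)
     (psub (pscal (2 * k) (psub (center c2) (center c1))) (psub T (center c1)))).
  assert (E : X = T).
  { apply tan; rewrite !on_circle_power; unfold X, n2 in *; clearbody k; clear X n2 tan.
    unfold power in *; revert K h1 h2; generalize (radius c1) (radius c2).
    destruct (center c1) as [o1 o2], (center c2) as [p1 p2], T as [t1 t2]; coordinates.
    intros R1 R2 K h1 h2; split.
    - rewrite <- h1; apply Rminus_diag_uniq.
      transitivity (4 * k * (k * ((p1 - o1) * (p1 - o1) + (p2 - o2) * (p2 - o2)) -
         ((t1 - o1) * (p1 - o1) + (t2 - o2) * (p2 - o2)))); [ring | rewrite K; ring].
    - rewrite <- h2; apply Rminus_diag_uniq.
      transitivity ((4 * k - 4) * (k * ((p1 - o1) * (p1 - o1) + (p2 - o2) * (p2 - o2)) -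
         ((t1 - o1) * (p1 - o1) + (t2 - o2) * (p2 - o2)))); [ring | rewrite K; ring]. }
  (* Being its own mirror image, [T] lies on the line of centres; a positive radius then excludes
     [k = 0]. *)
  assert (F : psub T (center c1) = pscal k (psub (center c2) (center c1))).
  { unfold X in E; clear - E; clearbody k.
    destruct (center c1) as [o1 o2], (center c2) as [p1 p2]; coordinates.
    injection E; intros; f_equal; lra. }
  assert (k <> 0).
  { intros e; rewrite e in F; unfold power, sqdist in h1; rewrite F in h1; unfold dot, pscal in h1;
      simpl in h1; nra. }
  exists (/ k); rewrite F; clear - H; clearbody k.
  destruct (center c1) as [o1 o2], (center c2) as [p1 p2]; coordinates; f_equal; field; trivial.
Qed.

(** Tangency makes [c1] the image of [c] under the homothety of centre [A'] and ratio [1 - m], so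
    [power c1 X = (1 - m) * power c X + m * sqdist A' X] for every X. Taking X = [P] determines [m];
    taking X = [B] gives the power sought. *)
Lemma power_tangent_circle A B C P A' c c1 u v w :
  cross (psub B A) (psub C A) <> 0 ->
  0 < u -> 0 < v -> 0 < w -> barycentric A B C P u v w ->
  on_circle c A -> on_circle c B -> on_circle c C ->
  line A P A' -> on_circle c A' -> A' <> A ->
  on_circle c1 A' -> on_circle c1 P -> tangent_at c c1 A' ->
  (v * sqdist A B + w * sqdist A C) * power c1 B =
    w * w * sqdist B C * sqdist A C.
Proof.
  intros hx u0 v0 w0 [h1 hP] hA hB hC [t hA'] hA'c hn h1A' h1P tan.
  destruct (tangent_at_center _ _ _ hA'c h1A' tan) as [m hm].
  destruct (cross_neq _ _ _ hx) as [nAB [nBC nCA]].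
  rewrite on_circle_power in *.
  apply sqdist_pos in nAB, nBC, nCA; rewrite sqdist_sym in nCA.
  assert (t0 : t <> 0).
  { intros e; apply hn; rewrite hA', e; coordinates; f_equal; ring. }
  assert (E : sqdist A P = v * v * sqdist A B + w * w * sqdist A C
     + v * w * (sqdist A B + sqdist A C - sqdist B C)).
  { rewrite hP; replace u with (1 - v - w) by lra; coordinates; ring. }
  assert (E0 : 0 < sqdist A P).
  { apply sqdist_pos; intros e; apply hx, (Rmult_eq_reg_l v); [|lra].
    transitivity (cross (psub P A) (psub C A)).
    - rewrite hP; replace u with (1 - v - w) by lra; clear; coordinates; ring.
    - rewrite <- e; clear; coordinates; ring. }
  set (S := v * sqdist A B + w * sqdist A C) in *.
  (* An interior point of the triangle is inside the circumcircle: the vertices have power zero and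
     only negative terms remain. *)
  assert (I : power c P < 0).
  { replace (power c P) with (u * power c A + v * power c B + w * power c C
        - u * v * sqdist A B - v * w * sqdist B C - u * w * sqdist A C).
    - rewrite hA, hB, hC; assert (0 < u * v) by nra; assert (0 < v * w) by nra;
        assert (0 < u * w) by nra; nra.
    - rewrite hP; replace u with (1 - v - w) by lra; unfold power; clear.
      destruct (center c); coordinates; ring. }
  assert (EP : power c P = sqdist A P - S).
  { replace (power c P) with (power c A + sqdist A P - S
        + v * (power c B - power c A) + w * (power c C - power c A)).
    - rewrite hA, hB, hC; ring.
    - unfold S; rewrite hP; replace u with (1 - v - w) by lra; unfold power; clear.
      destruct (center c); coordinates; ring. }
  (* The power of A + t(P - A) is quadratic in t with root 0 at [A]; the other root belongs to
     [A']. *)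
  assert (ET : t * sqdist A P = S).
  { apply (Rmult_eq_reg_l t); trivial.
    replace (t * (t * sqdist A P)) with
      (power c A' - power c A + t * (power c A + sqdist A P - power c P)).
    2:{ rewrite hA'; unfold power; clear; destruct (center c); coordinates; ring. }
    rewrite hA'c, hA, EP; ring. }
  (* The homothety formula at [P] becomes [(1 - m * t) * power c P = 0]. *)
  assert (mt : m * t = 1).
  { apply (Rmult_eq_reg_l (- power c P)); [|lra].
    assert (Q : power c1 P = power c1 A' + (1 - m) * (power c P - power c A')
        + m * sqdist A' P).
    { unfold power; rewrite hm; clear; destruct (center c); coordinates; ring. }
    rewrite h1P, h1A', hA'c in Q.
    replace (sqdist A' P) with ((1 - t) * (1 - t) * sqdist A P) in Q
      by (rewrite hA'; clear; coordinates; ring).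
    rewrite EP, <- ET in *. nra. }
  assert (Q : power c1 B = m * sqdist A' B).
  { assert (Q : power c1 B = power c1 A' + (1 - m) * (power c B - power c A')
        + m * sqdist A' B).
    { unfold power; rewrite hm; clear; destruct (center c); coordinates; ring. }
    rewrite Q, h1A', hA'c, hB; ring. }
  assert (W : sqdist A' B = sqdist A B + t * t * sqdist A P
     - t * (2 * v * sqdist A B + w * (sqdist A B + sqdist A C - sqdist B C))).
  { rewrite hA', hP; replace u with (1 - v - w) by lra; clear; coordinates; ring. }
  rewrite Q, W.
  (* Replacing one factor [S] by [t * sqdist A P] lets [m * t] be factored out of every term. *)
  transitivity (m * t * (sqdist A P * sqdist A B + S * S
    - S * (2 * v * sqdist A B + w * (sqdist A B + sqdist A C - sqdist B C)))).
  - rewrite <- ET; ring.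
  - rewrite mt, E; unfold S; ring.
Qed.

(* The difference of two powers is affine, so on a line it is determined by two points. *)
Lemma power_eq_on_line c1 c2 B C X Y :
  segment B C X -> segment B C Y -> X <> Y ->
  on_circle c1 X -> on_circle c1 Y -> on_circle c2 X -> on_circle c2 Y ->
  power c1 B = power c2 B /\ power c1 C = power c2 C.
Proof.
  intros [s [_ hX]] [t [_ hY]] n h1 h2 h3 h4; rewrite on_circle_power in *.
  assert (F : forall k, let Z := padd B (pscal k (psub C B)) in
    power c1 Z - power c2 Z =
    (1 - k) * (power c1 B - power c2 B) + k * (power c1 C - power c2 C)).
  { intros k; unfold power; clear; destruct (center c1), (center c2); coordinates; ring. }
  assert (Fs := F s); assert (Ft := F t); simpl in Fs, Ft.
  rewrite <- hX in Fs; rewrite <- hY in Ft; rewrite h1, h3 in Fs; rewrite h2, h4 in Ft.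
  assert (s - t <> 0).
  { intros e; apply n; rewrite hX, hY; now replace s with t by lra. }
  set (f := power c1 B - power c2 B) in *; set (g := power c1 C - power c2 C) in *.
  (* [Fs] and [Ft] form a homogeneous linear system in [f] and [g] with determinant [t - s]. *)
  assert (f = 0).
  { apply (Rmult_eq_reg_l (s - t)); trivial.
    transitivity (s * ((1 - t) * f + t * g) - t * ((1 - s) * f + s * g)); [ring|].
    rewrite <- Fs, <- Ft; ring. }
  assert (g = 0).
  { apply (Rmult_eq_reg_l (s - t)); trivial.
    transitivity ((1 - t) * ((1 - s) * f + s * g) - (1 - s) * ((1 - t) * f + t * g)); [ring|].
    rewrite <- Fs, <- Ft; ring. }
  unfold f, g in *; lra.
Qed.

(** Here [p] is the common power of a vertex with respect to two of the tangent circles; eliminating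
    it leaves [w * a - u * c] times a positive factor. *)
Lemma ratio_of_equal_powers a b c u v w p :
  0 < a -> 0 < b -> 0 < c -> 0 < u -> 0 < v -> 0 < w ->
  (v * c + w * b) * p = w * w * a * b ->
  (v * a + u * b) * p = u * u * c * b ->
  w * a = u * c.
Proof.
  intros a0 b0 c0 u0 v0 w0 h1 h2.
  assert (0 < w * a) by nra; assert (0 < u * c) by nra.
  assert (0 < u * w * b) by (repeat apply Rmult_lt_0_compat; trivial).
  assert (0 < v * (w * a + u * c)) by (apply Rmult_lt_0_compat; lra).
  apply Rminus_diag_uniq.
  apply (Rmult_eq_reg_l (b * (u * w * b + v * (w * a + u * c)))).
  2: { apply Rgt_not_eq, Rmult_lt_0_compat; lra. }
  transitivity ((v * a + u * b) * (w * w * a * b) - (v * c + w * b) * (u * u * c * b)).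
  - ring.
  - rewrite <- h1, <- h2; ring.
Qed.

(** * Angles and the internal bisector *)

(** Cauchy-Schwarz, which places the argument of [acos] where [acos] is injective. *)
Lemma dot_le_pdist A X Y :
  -1 <= dot (psub X A) (psub Y A) / (pdist A X * pdist A Y) <= 1.
Proof.
  assert (CS : forall p q d, 0 < p -> 0 < q -> d * d <= p * p * (q * q) -> -1 <= d / (p * q) <= 1).
  { intros p q d hp hq H; assert (0 < p * q) by nra.
    assert (Q : d / (p * q) * (p * q) = d) by (field; lra).
    split; apply (Rmult_le_reg_r (p * q)); trivial; rewrite Q; nra. }
  destruct (Req_dec (pdist A X * pdist A Y) 0) as [e|n].
  (* If [X] or [Y] equals [A], the quotient has the default value 0. *)
  { rewrite e; unfold Rdiv; rewrite Rinv_0; lra. }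
  generalize (pdist_nonneg A X) (pdist_nonneg A Y); intros hX hY.
  apply CS; [nra|nra|].
  rewrite !pdist_sqr; clear; destruct A as [a1 a2], X as [x1 x2], Y as [y1 y2]; coordinates.
  apply Rminus_le; generalize (Rle_0_sqr ((x1 - a1) * (y2 - a2) - (x2 - a2) * (y1 - a1))); unfold Rsqr; lra.
Qed.

Lemma acos_inj x y : -1 <= x <= 1 -> -1 <= y <= 1 -> acos x = acos y -> x = y.
Proof. intros hx hy e; rewrite <- (cos_acos x), <- (cos_acos y), e; trivial. Qed.

Lemma segment_angle_eq A B C D :
  cross (psub B A) (psub C A) <> 0 -> segment B C D ->
  angle B A D = angle D A C <->
  pdist A C * dot (psub B A) (psub D A) = pdist A B * dot (psub D A) (psub C A).
Proof.
  intros hx [t [_ hD]].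
  assert (nD : A <> D).
  { intros e; apply hx; rewrite <- e in hD; clear e D.
    destruct A as [a1 a2], B as [b1 b2], C as [c1 c2]; coordinates; injection hD; intros; subst; ring. }
  destruct (cross_neq _ _ _ hx) as [nAB [nBC nCA]].
  apply pdist_pos in nAB, nCA, nD; rewrite pdist_sym in nCA.
  assert (Q : dot (psub B A) (psub D A) / (pdist A B * pdist A D) =
    dot (psub D A) (psub C A) / (pdist A D * pdist A C) <->
  pdist A C * dot (psub B A) (psub D A) = pdist A B * dot (psub D A) (psub C A)).
  { generalize (dot (psub B A) (psub D A)) (dot (psub D A) (psub C A)); intros x y.
    assert (N : pdist A B * pdist A C * pdist A D <> 0)
      by (apply Rgt_not_eq; repeat apply Rmult_lt_0_compat; trivial).
    split; intros e.
    - apply (f_equal (Rmult (pdist A B * pdist A C * pdist A D))) in e.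
      field_simplify in e; lra.
    - apply (Rmult_eq_reg_l (pdist A B * pdist A C * pdist A D)); trivial.
      field_simplify; lra. }
  rewrite <- Q; unfold angle; split; intros e.
  - apply acos_inj; trivial; apply dot_le_pdist.
  - now rewrite e.
Qed.

(** The direction is a positive multiple of the sum of the unit vectors along AB and AC. In the
    proof [b] and [c] are lengths, not their squares. *)
Lemma internal_bisector_iff A B C X :
  cross (psub B A) (psub C A) <> 0 ->
  internal_bisector A B C X <->
  line A (padd A (padd (pscal (pdist A C) (psub B A)) (pscal (pdist A B) (psub C A)))) X.
Proof.
  intros hx.
  destruct (cross_neq _ _ _ hx) as [nAB [_ nCA]].
  apply pdist_pos in nAB, nCA; rewrite pdist_sym in nCA.
  assert (S : 0 < pdist A B + pdist A C) by lra.
  assert (hc := pdist_sqr A B); assert (hb := pdist_sqr A C).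
  set (c := pdist A B) in *; set (b := pdist A C) in *.
  (* The bisector theorem: BD : DC = c : b. The angle condition factors as [c - t * (b + c)] times a
     quantity that vanishes only for a flat triangle. *)
  assert (G : forall D t, D = padd B (pscal t (psub C B)) ->
    (b * dot (psub B A) (psub D A) = c * dot (psub D A) (psub C A) <-> t = c / (b + c))).
  { intros D t hD.
    assert (Q : b * dot (psub B A) (psub D A) - c * dot (psub D A) (psub C A) =
      (c - t * (b + c)) * (b * c - dot (psub B A) (psub C A))).
    { assert (Q : b * dot (psub B A) (psub D A) - c * dot (psub D A) (psub C A) =
        b * ((1 - t) * sqdist A B + t * dot (psub B A) (psub C A))
        - c * ((1 - t) * dot (psub B A) (psub C A) + t * sqdist A C)).
      { rewrite hD; clear; clearbody b c; coordinates; ring. }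
      rewrite Q, <- hc, <- hb; ring. }
    assert (N : b * c - dot (psub B A) (psub C A) <> 0).
    { intros e; apply hx.
      (* Lagrange's identity for the squares of the cross and dot products. *)
      assert (Z : cross (psub B A) (psub C A) * cross (psub B A) (psub C A) =
        (b * c - dot (psub B A) (psub C A)) * (b * c + dot (psub B A) (psub C A))).
      { transitivity ((c * c) * (b * b) - dot (psub B A) (psub C A) * dot (psub B A) (psub C A)); [|ring].
        rewrite hc, hb; clear; coordinates; ring. }
      rewrite e in Z; nra. }
    split; intros e.
    - assert (Z : c - t * (b + c) = 0).
      { apply (Rmult_eq_reg_r (b * c - dot (psub B A) (psub C A))); trivial; lra. }
      apply (Rmult_eq_reg_r (b + c)); [|lra]; field_simplify; lra.
    - assert (Z : c - t * (b + c) = 0) by (rewrite e; field; lra).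
      rewrite Z in Q; lra. }
  split.
  - intros [D [hD [ha [s hX]]]].
    assert (hD' := hD); destruct hD' as [t [_ ht]].
    apply (segment_angle_eq _ _ _ _ hx hD), (G _ _ ht) in ha.
    exists (s / (b + c)); rewrite hX, ht, ha; clear - S; clearbody b c.
    coordinates; f_equal; field; lra.
  - intros [s hX].
    set (D := padd B (pscal (c / (b + c)) (psub C B))).
    assert (hD : segment B C D).
    { exists (c / (b + c)); split; trivial.
      assert (0 < c / (b + c)) by (apply Rdiv_lt_0_compat; lra).
      assert (0 < b / (b + c)) by (apply Rdiv_lt_0_compat; lra).
      assert (c / (b + c) + b / (b + c) = 1) by (field; lra).
      lra. }
    exists D; split; [|split]; trivial.
    + apply (segment_angle_eq _ _ _ _ hx hD); apply (G _ (c / (b + c))); reflexivity.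
    + exists (s * (b + c)); rewrite hX; unfold D; clear - S; clearbody b c.
      coordinates; f_equal; field; lra.
Qed.

(** * Symmedians in barycentric coordinates *)

(** With lengths [b], [c] the hypothesis reads v : w = b^2 : c^2. Reflection in the bisector
    exchanges b(B - A) and c(C - A), two vectors of length bc, and so carries a point of the median
    to [P]. *)
Lemma symmedian_barycentric A B C P u v w :
  cross (psub B A) (psub C A) <> 0 -> barycentric A B C P u v w ->
  v * sqdist A B = w * sqdist A C -> symmedian A B C P.
Proof.
  intros hx [h1 hP] hvw.
  destruct (cross_neq _ _ _ hx) as [nAB [_ nCA]].
  apply pdist_pos in nAB, nCA; rewrite pdist_sym in nCA.
  assert (hb := fun X => internal_bisector_iff A B C X hx).
  assert (h2 := pdist_sqr A B); assert (h3 := pdist_sqr A C).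
  set (c := pdist A B) in *; set (b := pdist A C) in *.
  set (k := v / (b * b)).
  assert (hv : v = k * (b * b)) by (unfold k; field; lra).
  assert (hw : w = k * (c * c)).
  { apply (Rmult_eq_reg_r (b * b)); [|nra].
    rewrite h3, <- hvw, hv, <- h2, <- h3; ring. }
  (* This is the mirror image of [P] = A + k(b^2 (B - A) + c^2 (C - A)). *)
  exists (padd A (pscal (k * b * c) (padd (psub B A) (psub C A)))).
  split; [|split].
  - exists (2 * k * b * c); clear; clearbody b c k; coordinates; f_equal; field.
  - apply hb; exists (k * (b + c) / 2).
    rewrite hP, hv, hw; replace u with (1 - k * (b * b) - k * (c * c)) by lra.
    clear; clearbody b c k; coordinates; f_equal; field.
  (* The displacement is k(b - c)(b(B - A) - c(C - A)); the difference and the sum of vectors of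
     equal length are orthogonal. *)
  - intros U V hU hV; apply hb in hU, hV; destruct hU as [s ->], hV as [t ->].
    transitivity ((t - s) * (k * (b - c) * (b * b * sqdist A B - c * c * sqdist A C))).
    + rewrite hP, hv, hw; replace u with (1 - k * (b * b) - k * (c * c)) by lra.
      clear; clearbody b c k; coordinates; ring.
    + rewrite <- h2, <- h3; ring.
Qed.

Theorem theorem5p1
  (A B C P A' B' C' : point)
  (Ab Ac Bc Ba Ca Cb : point)
  (w w1 w2 w3 : circle)
  (hABC : is_triangle A B C)
  (hw : on_circle w A /\ on_circle w B /\ on_circle w C)
  (hP : inside_triangle A B C P)
  (hA' : line A P A' /\ on_circle w A' /\ A' <> A)
  (hB' : line B P B' /\ on_circle w B' /\ B' <> B)
  (hC' : line C P C' /\ on_circle w C' /\ C' <> C)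
  (hw1 : on_circle w1 A' /\ on_circle w1 P /\ tangent_at w w1 A')
  (hw2 : on_circle w2 B' /\ on_circle w2 P /\ tangent_at w w2 B')
  (hw3 : on_circle w3 C' /\ on_circle w3 P /\ tangent_at w w3 C')
  (hBC : Ab <> Ac /\ (segment B C Ab /\ on_circle w1 Ab) /\
                     (segment B C Ac /\ on_circle w1 Ac))
  (hCA : Bc <> Ba /\ (segment C A Bc /\ on_circle w2 Bc) /\
                     (segment C A Ba /\ on_circle w2 Ba))
  (hAB : Ca <> Cb /\ (segment A B Ca /\ on_circle w3 Ca) /\
                     (segment A B Cb /\ on_circle w3 Cb))
  (hsix : exists g : circle,
      on_circle g Ab /\ on_circle g Ac /\
      on_circle g Bc /\ on_circle g Ba /\
      on_circle g Ca /\ on_circle g Cb) :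
  is_lemoine_point A B C P.
Proof.
  apply is_triangle_cross in hABC.
  (* The third barycentric coordinate is called [z], because [w] is the circumcircle. *)
  destruct hw as [cA [cB cC]], hP as [u [v [z [u0 [v0 [z0 [h1 hP]]]]]]].
  destruct hA' as [lA [oA nA]], hB' as [lB [oB nB]], hC' as [lC [oC nC]].
  destruct hw1 as [w1A [w1P tan1]], hw2 as [w2B [w2P tan2]], hw3 as [w3C [w3P tan3]].
  destruct hBC as [nBC [[sAb oAb] [sAc oAc]]], hCA as [nCA [[sBc oBc] [sBa oBa]]],
    hAB as [nAB [[sCa oCa] [sCb oCb]]], hsix as [g [g1 [g2 [g3 [g4 [g5 g6]]]]]].
  assert (b1 : barycentric A B C P u v z) by (split; trivial).
  assert (b2 := barycentric_rot _ _ _ _ _ _ _ b1).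
  assert (b3 := barycentric_rot _ _ _ _ _ _ _ b2).
  assert (x2 := hABC); rewrite <- cross_rot in x2.
  assert (x3 := x2); rewrite <- cross_rot in x3.
  assert (swap : forall X Y Z, cross (psub Y X) (psub Z X) <> 0 -> cross (psub Z X) (psub Y X) <> 0).
  { intros X Y Z h; rewrite cross_swap; lra. }
  destruct (power_eq_on_line w1 g B C Ab Ac) as [p1B p1C]; trivial.
  destruct (power_eq_on_line w2 g C A Bc Ba) as [p2C p2A]; trivial.
  destruct (power_eq_on_line w3 g A B Ca Cb) as [p3A p3B]; trivial.
  (* [B] is compared through [w1] and [w3], [C] through [w1] and [w2]; the vertex order puts first
     the vertex whose line meets the circumcircle at the point of tangency, and second the one whose
     power is taken. *)
  assert (q1B := power_tangent_circle A B C P A' w w1 u v z); rewrite p1B in q1B.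
  assert (q3B := power_tangent_circle C B A P C' w w3 z v u); rewrite p3B in q3B.
  assert (q1C := power_tangent_circle A C B P A' w w1 u z v); rewrite p1C in q1C.
  assert (q2C := power_tangent_circle B C A P B' w w2 v z u); rewrite p2C in q2C.
  destruct (cross_neq _ _ _ hABC) as [dAB [dBC dCA]].
  apply sqdist_pos in dAB, dBC, dCA.
  rewrite ?(sqdist_sym C B), ?(sqdist_sym B A), ?(sqdist_sym A C) in *.
  assert (rB : z * sqdist B C = u * sqdist A B).
  { apply (ratio_of_equal_powers _ (sqdist C A) _ _ v _ (power g B)); trivial.
    - apply q1B; trivial.
    - apply q3B; trivial; [apply swap; trivial | apply barycentric_swap; trivial]. }
  assert (rC : v * sqdist B C = u * sqdist C A).
  { apply (ratio_of_equal_powers _ (sqdist A B) _ _ z _ (power g C)); trivial.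
    - apply q1C; trivial; [apply swap; trivial | apply barycentric_swap; trivial].
    - apply q2C; trivial. }
  split; [|split].
  (* The ratio at [A] follows from [rB] and [rC] after cancelling [sqdist B C]. *)
  - apply (symmedian_barycentric A B C P u v z); trivial.
    rewrite (sqdist_sym A C); apply (Rmult_eq_reg_l (sqdist B C)); nra.
  - apply (symmedian_barycentric B C A P v z u); trivial.
    rewrite (sqdist_sym B A); trivial.
  - apply (symmedian_barycentric C A B P z u v); trivial.
    rewrite (sqdist_sym C B); lra.
Qed.
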